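(* Let $\mathcal{F}=\{w_1,\dots,w_N\}$ be a topologically contractive IFS (TIFS) on a Hausdorff topological space $X$, and let $A$ be the attractor of $\mathcal{F}$. Let $\sigma=(\sigma_n)_{n=1}^\infty\in\{1,\dots,N\}^\infty$ be a disjunctive sequence and let $x_0\in X$. Define $x_n=w_{\sigma_n}(x_{n-1})$ for $n\ge1$. Then $$\omega((x_n)):=\bigcap_{m=0}^\infty\overline{\{x_n:n\ge m\}}=A .$$
   Context: $\mathcal{K}(X)$ is the set of nonempty compact subsets of $X$ with the Vietoris topology (subbase: $\{K:K\subseteq V\}$, $\{K:K\cap V\neq\emptyset\}$, $V$ open). For continuous $w_1,\dots,w_N:X\to X$ put $\mathcal{F}(K)=\bigcup_{i=1}^N w_i(K)$. Let $I=\{1,\dots,N\}$; for $\alpha\in I^\infty$ write $w_{\alpha_{|k}}=w_{\alpha_1}\circ\cdots\circ w_{\alpha_k}$. $\mathcal{F}$ is a TIFS if all $w_i$ are continuous and: (1) for every $K\in\mathcal{K}(X)$ there is $C\in\mathcal{K}(X)$ with $K\subseteq C$, $\mathcal{F}(C)\subseteq C$; (2) for every $C\in\mathcal{K}(X)$ with $\mathcal{F}(C)\subseteq C$ and every $\alpha\in I^\infty$, $\bigcap_k w_{\alpha_{|k}}(C)$ is a singleton. The attractor of $\mathcal{F}$ is the set $A\in\mathcal{K}(X)$ with $\mathcal{F}(A)=A$ and $\mathcal{F}^k(K)\to A$ in the Vietoris topology for every $K\in\mathcal{K}(X)$ (a TIFS on a nonempty Hausdorff space has exactly one). A sequence $\sigma\in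 I^\infty$ is disjunctive if every finite word $\alpha\in I^k$, $k\ge1$, appears in $\sigma$: $(\sigma_n,\dots,\sigma_{n+k-1})=\alpha$ for some $n\ge1$. *)

(* Defs.v *)
From HB Require Import structures.
From mathcomp Require Import all_boot all_order.
From mathcomp Require Import boolp classical_sets functions cardinality filter.
From mathcomp Require Import topology.

Set Implicit Arguments.
Unset Strict Implicit.
Unset Printing Implicit Defensive.

Local Open Scope classical_set_scope.

Record hyperspace (X : topologicalType) := Hyperspace {
  hyperspace_set :> set X;
  hyperspace_neq0 : hyperspace_set !=set0;
  hyperspace_compact : compact hyperspace_set }.

HB.instance Definition _ (X : topologicalType) := gen_eqMixin (hyperspace X).
HB.instance Definition _ (X : topologicalType) := gen_choiceMixin (hyperspace X).

Definition vietoris_subbase (X : topologicalType) : set (set (hyperspace X)) :=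
  [set [set K : hyperspace X | K `<=` V] | V in open] `|`
  [set [set K : hyperspace X | K `&` V !=set0] | V in open].

HB.instance Definition _ (X : topologicalType) :=
  isSubBaseTopological.Build (hyperspace X) (@vietoris_subbase X) id.

Record ifs (X : topologicalType) := Ifs {
  ifs_size : nat;
  ifs_size_gt0 : (0 < ifs_size)%N;
  ifs_map :> 'I_ifs_size -> X -> X;
  ifs_continuous : forall i, continuous (ifs_map i) }.

Section ifs.
Variables (X : topologicalType) (F : ifs X).

Lemma hutchinson_neq0 (K : hyperspace X) : \bigcup_i F i @` K !=set0.
Proof.
have [x Kx] := hyperspace_neq0 K.
pose i := Ordinal (ifs_size_gt0 F).
by exists (F i x), i => //; exists x.
Qed.

Lemma hutchinson_compact (K : hyperspace X) : compact (\bigcup_i F i @` K).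
Proof.
rewrite -(bigsetU_fset_set _ finite_finset).
apply: bigsetU_compact => i _.
apply: continuous_compact; last exact: hyperspace_compact.
by apply: continuous_subspaceT; exact: ifs_continuous.
Qed.

Definition hutchinson (K : hyperspace X) : hyperspace X :=
  Hyperspace (hutchinson_neq0 K) (@hutchinson_compact K).

(* Sequences indexed from 1 in the mathematics are functions on nat here, so
   [alpha i] is the (i+1)-st letter and the first [k] letters are those with
   index [i < k]; the product is F (alpha 0) \o ... \o F (alpha k.-1). *)
Definition word_map (alpha : nat -> 'I_(ifs_size F)) (k : nat) : X -> X :=
  \big[comp/id]_(i < k) F (alpha i).

Definition tifs : Prop :=
  (forall K : hyperspace X,
     exists2 C : hyperspace X, K `<=` C & hutchinson C `<=` C) /\
  (forall C : hyperspace X, hutchinson C `<=` C ->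
     forall alpha : nat -> 'I_(ifs_size F), exists x : X,
       \bigcap_(k in [set k | (1 <= k)%N]) (word_map alpha k @` C) = [set x]).

Definition is_attractor (A : hyperspace X) : Prop :=
  hutchinson A = A /\
  forall K : hyperspace X, (fun k => iter k hutchinson K) @ \oo --> A.

End ifs.

Definition disjunctive (T : Type) (sigma : nat -> T) : Prop :=
  forall u : seq T, (1 <= size u)%N ->
    exists n, mkseq (fun i => sigma (n + i)%N) (size u) = u.

Definition omega_limit (X : topologicalType) (x : nat -> X) : set X :=
  \bigcap_m closure [set x n | n in [set n | (m <= n)%N]].

(* Main.v *)
(** Upper bound: [x n] lies in [iter n hutchinson {x0}], which is eventually
    inside every open set containing [A], and a point outside the compact set
    [A] has a neighbourhood whose closure misses [A].
    Lower bound: a point [a] of [A] has an address [alpha], that is, [a] lies in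
    [word_map alpha k @` A] for all [k].  If [C] is a compact invariant set
    containing [A] and [x0], the compact sets [word_map alpha k @` C] decrease
    to [a], hence enter any neighbourhood of [a].  The reversed prefix of length
    [k] of [alpha] occurs arbitrarily late in the driving sequence, and right
    after such an occurrence the orbit is in [word_map alpha k @` C]. *)
Require Import Defs.
From mathcomp Require Import all_boot all_order.
From mathcomp Require Import boolp classical_sets functions cardinality filter.
From mathcomp Require Import topology.

Set Implicit Arguments.
Unset Strict Implicit.
Unset Printing Implicit Defensive.

Local Open Scope classical_set_scope.

Lemma hyperspace_open_subset (X : topologicalType) (V : set X) :
  open V -> open [set K : hyperspace X | K `<=` V].
Proof.
move=> oV; exists [set [set K : hyperspace X | K `<=` V]]; last first.
  by rewrite bigcup_set1.
move=> _ ->; apply: (finI_from1 id).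
by left; exists V.
Qed.

(** In a Hausdorff space [nbhs y] clusters only at [y], so each point of [A] has a neighbourhood
    disjoint from one of [y]; compactness, in near-covering form, makes one [W] serve all of [A]. *)
Lemma compact_notin_nbhs_closure (X : topologicalType) (A : set X) (y : X) :
  hausdorff_space X -> compact A -> ~ A y ->
  exists2 W, nbhs y W & A `<=` ~` closure W.
Proof.
move=> hX /compact_near_coveringP cA nAy.
apply/(@near_powerset_filter_fromP _ (nbhs y) (fun W => A `<=` ~` closure W)).
  by move=> B W BW AW a Aa /(closureS BW); exact: AW.
apply: cA => a Aa; have : ~ cluster (nbhs y) a.
  by move=> /hX ya; apply: nAy; rewrite ya.
case/existsNP=> B /existsPNP [D] yB /existsNP [aD] /nonemptyPn BD0.
exists (interior D, [set W | nbhs y W /\ W `<=` B]).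
  by split; [exact: nbhs_interior | exact: powerset_filter_fromP].
case=> t W [/= Dt [_ WB]] /(_ _ Dt) [z [/WB Bz Dz]].
by have : (B `&` D) z by []; rewrite BD0.
Qed.

Lemma hyperspace_cvg_closure (X : topologicalType) (K : nat -> hyperspace X)
    (A : hyperspace X) (x : nat -> X) :
  hausdorff_space X -> (forall n, (K n : set X) (x n)) -> K @ \oo --> A ->
  omega_limit x `<=` A.
Proof.
move=> hX Kx KA y ycl; apply: contrapT => nAy.
have [W yW AW] := compact_notin_nbhs_closure hX (@hyperspace_compact _ A) nAy.
have oV : open (~` closure W) by apply: closed_openC; exact: closed_closure.
have [m _ Km] := KA _ (open_nbhs_nbhs (conj (hyperspace_open_subset oV) AW)).
have [_ [[n /= mn <-] Wxn]] := ycl m I W yW.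
exact: Km (Kx n) (subset_closure Wxn).
Qed.

Section word_map.
Context {X : topologicalType} (F : ifs X).
Implicit Types (alpha : nat -> 'I_(ifs_size F)) (C : set X).

Lemma word_map0 alpha : word_map alpha 0 = id.
Proof. by rewrite /word_map big_ord0. Qed.

Lemma word_mapS alpha k :
  word_map alpha k.+1 = F (alpha 0%N) \o word_map (fun i => alpha i.+1) k.
Proof. by rewrite /word_map big_ord_recl. Qed.

Lemma word_mapSr alpha k :
  word_map alpha k.+1 = word_map alpha k \o F (alpha k).
Proof.
elim: k alpha => [|k IHk] alpha; first by rewrite word_mapS !word_map0.
by rewrite word_mapS IHk word_mapS.
Qed.

Lemma word_map_continuous alpha k : continuous (word_map alpha k).
Proof.
elim: k => [|k IHk] x; first by rewrite word_map0; exact: cvg_id.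
rewrite word_mapSr; apply: continuous_comp; last exact: IHk.
exact: ifs_continuous.
Qed.

Lemma ifs_map_stable C i x : \bigcup_i F i @` C `<=` C -> C x -> C (F i x).
Proof. by move=> FC Cx; apply: FC; exists i => //; exists x. Qed.

Lemma word_map_image_anti C alpha k n :
  \bigcup_i F i @` C `<=` C -> (k <= n)%N ->
  word_map alpha n @` C `<=` word_map alpha k @` C.
Proof.
move=> FC /subnK <-; elim: (n - k)%N => [//|d IHd] y [c Cc <-].
apply: IHd; rewrite addSn word_mapSr.
by exists (F (alpha (d + k)%N) c) => //; exact: ifs_map_stable.
Qed.

(** Preimages inside [A] are chosen again and again, starting from [a]; the indices of the maps used
    spell [alpha]. *)
Lemma invariant_address (A : set X) a : A `<=` \bigcup_i F i @` A -> A a ->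
  exists alpha, forall k, (word_map alpha k @` A) a.
Proof.
move=> AF Aa.
have step (z : X) : exists iy : 'I_(ifs_size F) * X,
    A z -> A iy.2 /\ F iy.1 iy.2 = z.
  have [/AF [i _ [y Ay <-]]|nAz] := pselect (A z).
    by exists (i, y).
  (* Dummy value off [A], which makes the choice function total. *)
  by exists (Ordinal (ifs_size_gt0 F), z).
have [f fP] := choice step.
pose s := fun k => iter k (fun z => (f z).2) a.
have As k : A (s k) by elim: k => [//|k /fP []].
exists (fun k => (f (s k)).1) => k.
exists (s k) => //; elim: k => [|k IHk]; first by rewrite word_map0.
by rewrite word_mapSr /= (fP _ (As k)).2.
Qed.

(** Otherwise points [y n] of the images avoid [U]. A cluster point of [y] lies in every image,
    since these are closed and decreasing, so it is the unique common point [a], interior to [U]. *)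
Lemma tifs_word_map_small (C : hyperspace X) alpha a U :
  hausdorff_space X -> tifs F -> \bigcup_i F i @` C `<=` C ->
  (forall k, (word_map alpha k @` C) a) ->
  nbhs a U -> exists2 k, (0 < k)%N & word_map alpha k @` C `<=` U.
Proof.
move=> hX [_ hF] FC aC aU; apply: contrapT => noU.
have bad k : exists y, (word_map alpha k.+1 @` C) y /\ ~ U y.
  apply: contrapT => nb; apply: noU; exists k.+1 => // y Cy.
  by apply: contrapT => nUy; apply: nb; exists y.
have [y yP] := choice bad.
have yC k n : (k <= n.+1)%N -> (word_map alpha k @` C) (y n).
  by move=> kn; apply: word_map_image_anti (yP n).1.
have [z [_ zcl]] : C `&` cluster (y @ \oo) !=set0.
  apply: hyperspace_compact; exists 0%N => // n _ /=.
  by have := yC 0%N n isT; rewrite word_map0 image_id.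
have [b hb] := hF C FC alpha.
have zb : z = b.
  suff : [set b] z by [].
  rewrite -hb => k _.
  have cl : closed (word_map alpha k @` C).
    apply: compact_closed => //; apply: continuous_compact.
      by apply: continuous_subspaceT; exact: word_map_continuous.
    exact: hyperspace_compact.
  apply: cl => B zB; apply: zcl => //.
  by exists k => // n /= kn; apply: yC; exact: leqW.
have ab : a = b by suff : [set b] a by []; rewrite -hb => k _; exact: aC.
have [t [nUt Ut]] : ~` U `&` U !=set0; last exact: nUt.
apply: zcl; last by rewrite zb -ab.
by exists 0%N => // n _; exact: (yP n).2.
Qed.

(** The innermost map of [word_map alpha k] has the last letter and acts first, hence the
    reversal. *)
Lemma orbit_word_map (sigma : nat -> 'I_(ifs_size F)) (x : nat -> X) alpha k n :
  (forall m, x m.+1 = F (sigma m) (x m)) ->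
  (forall i, (i < k)%N -> sigma (n + i)%N = alpha (k - i.+1)%N) ->
  x (n + k)%N = word_map alpha k (x n).
Proof.
move=> hx; elim: k n => [|k IHk] n sa; first by rewrite word_map0 addn0.
rewrite addnS -addSn IHk => [|i ik].
  by rewrite hx word_mapSr /= -[in sigma _](addn0 n) sa // subn1.
by rewrite addSnnS sa.
Qed.

End word_map.

Lemma disjunctive_late (T : Type) (sigma : nat -> T) (u : seq T) m :
  disjunctive sigma -> (0 < size u)%N ->
  exists2 n, (m <= n)%N & mkseq (fun i => sigma (n + i)%N) (size u) = u.
Proof.
case: u => // t u hs _.
(* Padding by [m] letters in front pushes the occurrence of the word itself to [n + m]. *)
have [|n] := hs (nseq m t ++ t :: u); first by rewrite size_cat addnS.
rewrite size_cat size_nseq => e; exists (n + m)%N; first exact: leq_addl.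
apply: (@eq_from_nth _ t); rewrite size_mkseq // => i iu.
rewrite nth_mkseq //.
have := congr1 (fun s => nth t s (m + i)) e.
rewrite nth_mkseq ?ltn_add2l // nth_cat size_nseq.
by rewrite ltnNge leq_addr /= addKn addnA.
Qed.

Theorem theorem5p6 (X : topologicalType) (hX : hausdorff_space X)
  (F : ifs X) (hF : tifs F) (A : hyperspace X) (hA : is_attractor F A)
  (sigma : nat -> 'I_(ifs_size F)) (hsigma : disjunctive sigma)
  (x0 : X) (x : nat -> X) (hx0 : x 0%N = x0)
  (hx : forall n : nat, x n.+1 = F (sigma n) (x n)) :
  omega_limit x = A.
Proof.
have [FA cvA] := hA; apply/seteqP; split.
  pose K0 := Hyperspace (ex_intro [set x0] x0 erefl) (@compact_set1 X x0).
  apply: hyperspace_cvg_closure hX _ (cvA K0); elim=> [|n IHn] //=.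
  by rewrite hx; exists (sigma n) => //; exists (x n).
move=> a Aa m _ U aU.
(* [C] has to contain [x0] to trap the orbit, and [A] so that the address of [a] works in [C]. *)
have neq0 : (A : set X) `|` [set x0] !=set0 by exists a; left.
have cpt : compact ((A : set X) `|` [set x0]).
  by apply: compactU; [exact: hyperspace_compact | exact: compact_set1].
have [C KC FC] := hF.1 (Hyperspace neq0 cpt).
have Cx n : (C : set X) (x n).
  elim: n => [|n IHn]; first by rewrite hx0; apply: KC; right.
  by rewrite hx; exact: ifs_map_stable.
have [|alpha aA] := @invariant_address _ F A a _ Aa; first by rewrite -{1}FA.
have aC k : (word_map alpha k @` C) a.
  by have [b Ab <-] := aA k; exists b => //; apply: KC; left.
have [k k0 CU] := tifs_word_map_small hX hF FC aC aU.
have [|n mn] := @disjunctive_late _ _ (mkseq (fun i => alpha (k - i.+1)%N) k) m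
  hsigma; first by rewrite size_mkseq.
rewrite size_mkseq => sa; exists (x (n + k)%N); split.
  by exists (n + k)%N => //=; exact: leq_trans mn (leq_addr _ _).
apply: CU; rewrite (@orbit_word_map _ F sigma x alpha k n hx) => [|i ik].
  by exists (x n).
have := congr1 (fun s => nth (alpha 0%N) s i) sa.
by rewrite !nth_mkseq.
Qed.
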